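(* Let $t \ge 2$ be an integer. Over the alphabet $\{{\tt 0},{\tt 1}\}$ define $y = {\tt 0}{\tt 1}^{t-1}{\tt 0}$ and $x_i = {\tt 1}^{t-i-1}{\tt 0}{\tt 1}^{i+1}$ for $0 \le i \le t-2$, and let $S_t = \{{\tt 0}, x_0, x_1, \ldots, x_{t-2}, y\}$. Then $\mathrm{sc}(S_t^* ) \ge 2^{t-2}$.
   Context: For a regular language $L$ over $\{{\tt 0},{\tt 1}\}$, $\mathrm{sc}(L)$ is the number of states of the minimal (complete) DFA accepting $L$. *)

(* Defs.v *)
From mathcomp Require Import all_boot.
From mathcomp Require Import boolp.

Set Implicit Arguments.
Unset Strict Implicit.
Unset Printing Implicit Defensive.

Definition lang (A : Type) := seq A -> Prop.

(* The transition function is total, so every automaton here is complete. *)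
Record dfa (A : Type) := Dfa {
  dfa_state : finType;
  dfa_start : dfa_state;
  dfa_final : {pred dfa_state};
  dfa_step : dfa_state -> A -> dfa_state }.

Definition dfa_accept (A : Type) (M : dfa A) : lang A :=
  fun w => foldl (@dfa_step A M) (dfa_start M) w \in @dfa_final A M.

Definition accepted_by (A : Type) (L : lang A) (M : dfa A) : Prop :=
  forall w, dfa_accept M w <-> L w.

Definition has_dfa_of_size (A : Type) (L : lang A) (n : nat) : Prop :=
  exists2 M : dfa A, accepted_by L M & #|dfa_state M| = n.

Definition regular (A : Type) (L : lang A) : Prop :=
  exists M : dfa A, accepted_by L M.

Lemma regular_size (A : Type) (L : lang A) :
  regular L -> exists n, `[< has_dfa_of_size L n >].
Proof. by case=> M LM; exists #|dfa_state M|; apply/asboolP; exists M. Qed.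

(* The value 0 is taken only on non-regular languages: an automaton has a
   start state, so sc L > 0 exactly when L is regular. *)
Definition sc (A : Type) (L : lang A) : nat :=
  if pselect (regular L) is left regL then ex_minn (regular_size regL) else 0.

Lemma scP (A : Type) (L : lang A) : regular L ->
  has_dfa_of_size L (sc L) /\
  (forall M : dfa A, accepted_by L M -> sc L <= #|dfa_state M|).
Proof.
rewrite /sc; case: pselect => // regL _; case: ex_minnP => n /asboolP Ln minn.
by split=> // M LM; apply: minn; apply/asboolP; exists M.
Qed.

Lemma sc_gt0 (A : Type) (L : lang A) : 0 < sc L <-> regular L.
Proof.
split=> [|regL]; first by rewrite /sc; case: pselect.
by have [[M _ <-] _] := scP regL; apply/card_gt0P; exists (dfa_start M).
Qed.

Definition star (A : eqType) (L : lang A) : lang A :=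
  fun w => exists2 us : seq (seq A), {in us, forall u, L u} & w = flatten us.

(* The letters 0 and 1 are false and true. *)
Definition word_y (t : nat) : seq bool :=
  [:: false] ++ nseq (t - 1) true ++ [:: false].

Definition word_x (t i : nat) : seq bool :=
  nseq (t - i - 1) true ++ [:: false] ++ nseq (i + 1) true.

Definition lang_S (t : nat) : lang bool :=
  fun w => [\/ w = [:: false],
               exists2 i, 0 <= i <= t - 2 & w = word_x t i
             | w = word_y t].

(* Main.v *)
Require Import Defs.
From mathcomp Require Import all_boot.
From mathcomp Require Import zify.

Set Implicit Arguments.
Unset Strict Implicit.
Unset Printing Implicit Defensive.

(** Between consecutive zeros, a partially parsed word of [S_t^*] is described
by what remains of the current factor: [1^i] with [i < t], or [1^(t-1) 0] when
that zero opened the factor [y].  Number this last residual [t].  Reading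
[1^(t-1) 0] acts on a set of residuals, seen as a register of [t + 1] bits, as
a shift whose new bit [0] is the disjunction of the old bits [t - 1] and [t];
reading [1^t 0] clears the bits [0] and [t].  Starting from the word [0],
[t^2 - 1] shifts set all the bits below [t], after which [t] shifts, each one
optionally followed by a clearing, write an arbitrary word into these bits.
Since [1^n] with [n < t] is accepted exactly when bit [n] is set, an automaton
for [S_t^*] has at least [2^t] states. *)

(** * Star of a finite language *)

Section Star.
Variables (A : eqType) (L : lang A).

Lemma star_nil : star L [::].
Proof. by exists [::]. Qed.

Lemma star_cat u v : L u -> star L v -> star L (u ++ v).
Proof.
move=> Lu [us Lus ->]; exists (u :: us) => // x.
by rewrite inE => /predU1P[->|/Lus].
Qed.

Lemma star_consP a w :
  star L (a :: w) <-> exists u v, [/\ L (a :: u), w = u ++ v & star L v].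
Proof.
split=> [[us]|[u [v [Lu -> Lv]]]]; last exact: (star_cat Lu).
(* Leading empty factors are discarded, so that the first factor kept starts with [a]. *)
elim: us => [|[|b u] us IHus] //= Lus.
  by apply: IHus => x xus; apply: Lus; rewrite inE xus orbT.
case=> -> ->; exists u, (flatten us); split=> //; first by apply: Lus; rewrite mem_head.
by exists us => // x xus; apply: Lus; rewrite inE xus orbT.
Qed.

Definition after (v : seq A) : lang A := fun w => exists2 z, w = v ++ z & star L z.

Lemma after_nil w : after [::] w <-> star L w.
Proof. by split=> [[z ->]|Lw] //; exists w. Qed.

Lemma after_cat u v w : after (u ++ v) (u ++ w) <-> after v w.
Proof.
split=> [[z]|[z -> Lz]]; last by exists z; rewrite ?catA.
rewrite -catA => /eqP; rewrite eqseq_cat // => /andP[_ /eqP ->] Lz.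
by exists z.
Qed.

End Star.

(* The states are the sets of suffixes of words of [l] that may remain to be read. *)
Lemma regular_star_finite (A : choiceType) (L : lang A) (l : seq (seq A)) :
  (forall w, L w <-> w \in l) -> regular (star L).
Proof.
move=> Ll.
(* Adding [[::]] to [l] puts the empty suffix in [s] even when [l] is empty; the start state is its
   singleton. *)
pose s := [seq drop i u | u <- [::] :: l, i <- iota 0 (size u).+1].
have sP v : reflect (exists x, x ++ v \in [::] :: l) (v \in s).
  apply: (iffP allpairsPdep) => [[u [i [ul _ ->]]]|[x xvl]].
    by exists (take i u); rewrite cat_take_drop.
  exists (x ++ v), (size x); split=> //; last by rewrite drop_size_cat.
  by rewrite mem_iota /= add0n ltnS size_cat leq_addr.
(* Either a pending suffix loses its first letter [a], or an exhausted one gives way to a new factor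
   starting with [a]. *)
pose step (X : {set seq_sub s}) (a : A) : {set seq_sub s} :=
  [set q' | [exists q in X, (val q == a :: val q') ||
                            (val q == [::]) && (a :: val q' \in l)]].
pose fin : {pred {set seq_sub s}} :=
  [pred X : {set seq_sub s} | [exists q in X, val q == [::]]].
have run w : forall X : {set seq_sub s}, foldl step X w \in fin <->
    exists2 q, q \in X & after L (val q) w.
  elim: w => [|a w IHw] X /=.
    split=> [/exists_inP[q qX /eqP q0]|[q qX [z]]].
      by exists q => //; rewrite q0; apply/after_nil; exact: star_nil.
    by case Eq: (val q) => // _ _; apply/exists_inP; exists q => //; rewrite Eq.
  rewrite IHw; split.
    case=> q'; rewrite inE => /exists_inP[q qX Eq] [z -> Lz]; exists q => //.
    case/orP: Eq => [/eqP ->|/andP[/eqP -> /Ll Lq]]; first by exists z.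
    by apply/after_nil/star_consP; exists (val q'), z.
  case=> q qX; case Eq: (val q) => [|b v].
    move/after_nil/star_consP => [u [v [Lu -> Lv]]].
    have us : u \in s.
      by apply/sP; exists [:: a]; rewrite inE; apply/orP; right; apply/Ll.
    exists (SeqSub us); last by exists v.
    rewrite inE; apply/exists_inP; exists q => //.
    by rewrite Eq eqxx; apply/orP; right; apply/Ll.
  case=> z [-> ->] Lz.
  have vs : v \in s.
    have /sP[x xl] : b :: v \in s by rewrite -Eq; apply: valP.
    by apply/sP; exists (rcons x b); rewrite cat_rcons.
  exists (SeqSub vs); last by exists z.
  by rewrite inE; apply/exists_inP; exists q => //; rewrite Eq eqxx.
exists (@Dfa A {set seq_sub s} [set q | val q == [::]] fin step) => w.
rewrite /dfa_accept /= run; split=> [[q]|Lw].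
  by rewrite inE /= => /eqP -> /after_nil.
have s0 : [::] \in s by apply/sP; exists [::]; rewrite mem_head.
by exists (SeqSub s0); [rewrite inE | apply/after_nil].
Qed.

(* The automaton state reached by [w] determines which continuations [z i] are accepted. *)
Lemma leq_dfa_state_of_patterns (A : Type) (L : lang A) (n : nat)
    (z : 'I_n -> seq A) (M : dfa A) :
    (forall s : n.-tuple bool, exists w, forall i, tnth s i <-> L (w ++ z i)) ->
    accepted_by L M -> 2 ^ n <= #|dfa_state M|.
Proof.
move=> Ls LM.
pose pattern (q : dfa_state M) : n.-tuple bool :=
  [tuple foldl (@dfa_step A M) q (z i) \in @dfa_final A M | i < n].
have pattern_surj s : s \in codom pattern.
  have [w ws] := Ls s; apply/codomP.
  exists (foldl (@dfa_step A M) (dfa_start M) w).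
  apply: eq_from_tnth => i; rewrite tnth_mktuple -foldl_cat.
  by apply/idP/idP => [/ws/LM|/LM/ws].
rewrite -card_bool -card_tuple; apply: leq_trans (leq_image_card pattern _).
by apply: subset_leq_card; apply/subsetP.
Qed.

(** * The language [S_t^*] *)

Lemma regular_star_lang_S t : regular (star (lang_S t)).
Proof.
apply: (@regular_star_finite _ _
  [:: [:: false], word_y t & [seq word_x t i | i <- iota 0 (t - 2 + 1)]]) => w.
rewrite !inE; split.
  case=> [->|[i i_le ->]|->]; rewrite ?eqxx ?orbT //.
  by rewrite map_f ?orbT // mem_iota addn1.
case/or3P=> [/eqP ->|/eqP ->|/mapP[i]]; [exact: Or31 | exact: Or33 |].
by rewrite mem_iota addn1 => i_le ->; apply: Or32; exists i.
Qed.

Lemma nseq_true_false_inj a b (u v : seq bool) :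
  nseq a true ++ false :: u = nseq b true ++ false :: v -> a = b /\ u = v.
Proof.
by elim: a b => [|a IHa] [|b] //= [] => [->|/IHa[-> ->]].
Qed.

Section LangS.
Variable t : nat.
Hypothesis t_ge2 : 2 <= t.
Let S := lang_S t.

Definition residual (i : nat) : seq bool :=
  if i < t then nseq i true else nseq t.-1 true ++ [:: false].

Lemma residual_lt i : i < t -> residual i = nseq i true.
Proof. by rewrite /residual => ->. Qed.

Lemma residual_t : residual t = nseq t.-1 true ++ [:: false].
Proof. by rewrite /residual ltnn. Qed.

Lemma lang_S_false w : S w -> false \in w.
Proof.
by case=> [->|[i _ ->]|->]; rewrite ?mem_head // mem_cat mem_head orbT.
Qed.

Lemma star_S_ones n : star S (nseq n true) -> n = 0.
Proof.
case: n => // n /star_consP[u [v [/lang_S_false Su En _]]].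
have {}En : nseq n.+1 true = (true :: u) ++ v by congr cons; exact: En.
have: false \in nseq n.+1 true by rewrite En mem_cat Su.
by rewrite mem_nseq.
Qed.

(** A continuation without zeros can neither complete [y] nor contain a further factor, so it is
    exactly the residual. *)
Lemma after_ones i n : i <= t -> after S (residual i) (nseq n true) -> i < t /\ i = n.
Proof.
move=> it [z En Sz].
have noF : false \notin residual i ++ z by rewrite -En mem_nseq andbF.
move: noF En; rewrite /residual; case: ltnP => _; last first.
  by rewrite !mem_cat mem_head orbT.
move=> _ En; split=> //.
have Ez : z = nseq (n - i) true.
  by rewrite -(drop_nseq i n) En drop_size_cat // size_nseq.
have := congr1 size En; rewrite size_cat !size_nseq.
by move: Sz; rewrite Ez => /star_S_ones ->; rewrite addn0.
Qed.

(** The number of ones before the first zero determines the factor: none for [0] and [y], and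
    [a = t - i - 1] for [x_i], whose last [i + 1 = t - a] ones remain. *)
Lemma star_S_block a z : star S (nseq a true ++ false :: z) <->
  (a = 0 /\ (star S z \/ after S (residual t) z)) \/
  (0 < a < t /\ after S (residual (t - a)) z).
Proof.
split.
  have Ew : exists b w, nseq a true ++ false :: z = b :: w.
    by case: (a) => [|n] /=; eexists; eexists.
  case: Ew => b [w Ew]; rewrite Ew => /star_consP[u [v [Su Ewuv Sv]]].
  have {Ewuv}Ew' : nseq a true ++ false :: z = (b :: u) ++ v by rewrite Ew Ewuv.
  case: Su Ew' => [->|[i i_le ->]|->] {}Ew.
  - have [-> ->] := @nseq_true_false_inj a 0 _ _ Ew.
    by left; split=> //; left.
  - move: Ew; rewrite /word_x -!catA => /nseq_true_false_inj[-> ->].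
    right; split; first by lia.
    have -> : t - (t - i - 1) = i + 1 by lia.
    by rewrite residual_lt; [exists v | lia].
  - move: Ew; rewrite /word_y -catA => /(@nseq_true_false_inj a 0)[-> ->].
    by left; split=> //; right; rewrite residual_t subn1; exists v.
case=> [[-> [Sz|[v -> Sv]]]|[a_t]].
- by apply: (star_cat (u := [:: false])) => //; apply: Or31.
- rewrite residual_t (_ : _ ++ _ = word_y t ++ v); last first.
    by rewrite /word_y subn1 -!catA.
  by apply: star_cat => //; apply: Or33.
rewrite residual_lt; last by lia.
case=> v -> Sv; rewrite (_ : _ ++ _ = word_x t (t - a).-1 ++ v).
  by apply: star_cat => //; apply: Or32; exists (t - a).-1 => //; lia.
by rewrite /word_x -!catA; congr (nseq _ _ ++ _ :: nseq _ _ ++ _); lia.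
Qed.

Lemma after_residual_block i n z : i < t ->
  after S (residual i) (nseq n true ++ false :: z) <->
  i <= n /\ star S (nseq (n - i) true ++ false :: z).
Proof.
move=> it; rewrite residual_lt //; case: (leqP i n) => in_.
  rewrite -[in X in after _ _ X](subnKC in_) nseqD -catA.
  have := @after_cat _ S (nseq i true) [::] (nseq (n - i) true ++ false :: z).
  by rewrite cats0 after_nil => ->; split=> // -[].
split=> [[v Ev _]|[]] //; exfalso.
have := congr1 (fun w => nth true w n) Ev.
by rewrite !nth_cat !size_nseq ltnn subnn in_ /= nth_nseq in_.
Qed.

Lemma after_residual_t_block n z :
  after S (residual t) (nseq n true ++ false :: z) <-> n = t.-1 /\ star S z.
Proof.
rewrite residual_t; split=> [[v]|[-> Sz]].
  by rewrite -catA => /nseq_true_false_inj[-> ->].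
by exists z; rewrite -?catA.
Qed.

(** * The register and the words acting on it *)

Definition shift_word : seq bool := rcons (nseq t.-1 true) false.
Definition clear_word : seq bool := rcons (nseq t true) false.

Definition shift (W : nat -> bool) (i : nat) : bool :=
  if i is i'.+1 then W i' else W t.-1 || W t.
Definition clear (W : nat -> bool) (i : nat) : bool := (0 < i < t) && W i.

Definition register (w : seq bool) (W : nat -> bool) : Prop :=
  forall z, star S (w ++ z) <-> exists i, [/\ i <= t, W i & after S (residual i) z].

Lemma after_residual0 z : after S (residual 0) z <-> star S z.
Proof. by rewrite residual_lt ?after_nil //; lia. Qed.

(** The first zero is either a whole factor or the opening of [y]. *)
Lemma register_start : register [:: false] (fun i => (i == 0) || (i == t)).
Proof.
move=> z; rewrite (star_S_block 0); split.
  case=> [[_ [Sz|Sz]]|[]] //; last by exists t; rewrite eqxx orbT.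
  by exists 0; split=> //; apply/after_residual0.
case=> i [_ /orP[]/eqP -> Sz]; left; split=> //; last by right.
by left; apply/after_residual0.
Qed.

(** For [i < t - 1], the residual [1^i] leaves [t - 1 - i] ones, which open a factor with residual
    [i + 1]. For [i = t - 1] only the zero is left, giving bits 0 and [t]. The residual of [y] is
    completed, giving bit 0. *)
Lemma register_shift w W : register w W -> register (w ++ shift_word) (shift W).
Proof.
move=> wW z; rewrite -catA cat_rcons wW; split.
  case=> i []; rewrite leq_eqVlt => /predU1P[->|it] Wi.
    move/after_residual_t_block => [_ Sz]; exists 0; split=> //=.
      by rewrite Wi orbT.
    exact/after_residual0.
  case/(after_residual_block _ _ it) => _ /star_S_block[[it1 [Sz|Sz]]|[it1 Sz]].
  - exists 0; split=> //=; last exact/after_residual0.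
    by rewrite (_ : t.-1 = i) ?Wi //; lia.
  - exists t; split=> //; rewrite -(prednK (_ : 0 < t)) /=; last by lia.
    by rewrite (_ : t.-1 = i) //; lia.
  - exists i.+1; split=> //.
    by rewrite (_ : i.+1 = t - (t.-1 - i)) //; lia.
case=> -[|i] [it Wi Sz].
  move/after_residual0: Sz => Sz.
  case/orP: Wi => Wi; last by exists t; split=> //; apply/after_residual_t_block.
  exists t.-1; split=> //; first by lia.
  apply/after_residual_block; first by lia.
  by split=> //; apply/star_S_block; rewrite subnn; left; split=> //; left.
exists i; split=> //; first by lia.
apply/after_residual_block => //; split; first by lia.
apply/star_S_block; have [it1|it1] := eqVneq i.+1 t.
  by left; split; [lia | right; rewrite -it1].
right; split; first by lia.
by rewrite (_ : t - _ = i.+1) //; lia.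
Qed.

(** For [0 < i < t], the residual [1^i] leaves [t - i] ones, which open a factor with residual [i]
    again. For [i = 0] all [t] ones are left, too many to open a factor, and [y] needs exactly
    [t - 1]. *)
Lemma register_clear w W : register w W -> register (w ++ clear_word) (clear W).
Proof.
move=> wW z; rewrite -catA cat_rcons wW; split.
  case=> i []; rewrite leq_eqVlt => /predU1P[->|it] Wi.
    by move/after_residual_t_block => [tt _]; lia.
  case/(after_residual_block _ _ it) => _ /star_S_block[[it1 _]|[it1 Sz]]; first by lia.
  exists i; split; first by lia.
    by rewrite /clear Wi andbT; lia.
  by rewrite (_ : i = t - (t - i)) //; lia.
case=> i [it /andP[i0t Wi] Sz]; exists i; split=> //.
apply/after_residual_block; first by lia.
split=> //; apply/star_S_block; right; split; first by lia.
by rewrite (_ : t - _ = i) //; lia.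
Qed.

(* Each turn through the register lengthens a run of ones by one, as the last
   bit of the run is read twice. *)
Lemma iter_shift_run (W : nat -> bool) (k j i : nat) : W 0 -> j <= k ->
  iter (k * t + j + i) shift W i.
Proof.
move=> W0; elim: i k j => [|i IHi] k j jk; last by rewrite addnS /=; apply: IHi.
rewrite addn0.
have [m] := ubnP (k * t + j); elim: m k j jk => // m IHm k j jk km.
case: k jk km => [|k] jk km; first by move: jk; rewrite leqn0 => /eqP ->.
have shiftE p W' : forall l, iter (p + l) shift W' l = iter p shift W' 0.
  by elim=> [|l IHl]; rewrite ?addn0 // addnS /= IHl.
(* If [j <= k], bit 0 is fed by bit [t - 1], which was bit 0 [t] shifts earlier. *)
have [jk'|kj] := leqP j k.
  rewrite (_ : _ + _ = (k * t + j + t.-1).+1) /=; last by lia.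
  by rewrite shiftE IHm //; lia.
rewrite (_ : _ + _ = (k * t + k + t).+1) /=; last by lia.
by rewrite orbC shiftE IHm //; lia.
Qed.

Lemma register_iter_shift w W n : register w W -> exists w', register w' (iter n shift W).
Proof.
move=> wW; elim: n => [|n [w' wW']]; first by exists w.
by exists (w' ++ shift_word); apply: register_shift.
Qed.

Lemma register_full : exists w W, register w W /\ forall i, i < t -> W i.
Proof.
(* The count is [k * t + j + i] with [k = t - 1] and [j = t - 1 - i], the same for every [i < t]. *)
have [w wW] := register_iter_shift (t.-1 * t + t.-1) register_start.
eexists; eexists; split; first exact: wW.
move=> i it; have := @iter_shift_run (fun i => (i == 0) || (i == t)) t.-1 (t.-1 - i) i.
by rewrite -addnA subnK; [apply=> //; lia | lia].
Qed.

(** The bits are written from last to first; the default [true] stands for those of the full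
    register not yet overwritten. *)
Lemma register_any (s : seq bool) : size s <= t ->
  exists w W, register w W /\ forall i, i < t -> W i = nth true s i.
Proof.
elim: s => [|b s IHs] /= st.
  have [w [W [wW full]]] := register_full.
  by exists w, W; split=> // i it; rewrite full ?nth_nil.
have [w [W [wW Ws]]] := IHs (ltnW st).
(* Fewer than [t] bits are written so far, so bit [t - 1] is still set and the shift brings in a
   1. *)
have W1 : W t.-1 by rewrite Ws ?nth_default //; lia.
have wW' := register_shift wW.
have Ws' i : i < t -> shift W i = nth true (true :: s) i.
  by case: i => [|i] it /=; [rewrite W1 | apply: Ws; lia].
case: b; first by exists (w ++ shift_word), (shift W).
(* Among the bits below [t], clearing changes only the one just brought in. *)
exists ((w ++ shift_word) ++ clear_word), (clear (shift W)).
split; first exact: register_clear.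
by case=> [|i] it //; rewrite /clear it; apply: Ws'.
Qed.

Lemma register_ones w W n : register w W -> n < t -> star S (w ++ nseq n true) <-> W n.
Proof.
move=> wW nt; rewrite wW; split=> [[i [it Wi /(after_ones it)[_ <-]]]|Wn] //.
exists n; split; rewrite ?(ltnW nt) // residual_lt //.
by exists [::]; rewrite ?cats0 //; apply: star_nil.
Qed.

Lemma sc_star_lang_S : 2 ^ t <= sc (star S).
Proof.
have [[M SM <-] _] := scP (regular_star_lang_S t).
apply: (leq_dfa_state_of_patterns (z := fun i : 'I_t => nseq i true) _ SM) => s.
have [w [W [wW Ws]]] : exists w W,
    register w W /\ forall i, i < t -> W i = nth true s i.
  by apply: register_any; rewrite size_tuple.
exists w => i; rewrite (register_ones wW (ltn_ord i)) Ws ?ltn_ord //.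
by rewrite -tnth_nth.
Qed.

End LangS.

Theorem theorem8 (t : nat) (ht : 2 <= t) : 2 ^ (t - 2) <= sc (star (lang_S t)).
Proof.
apply: leq_trans (sc_star_lang_S ht).
by rewrite leq_exp2l // leq_subr.
Qed.
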